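(* A sequence $X=(x_k: k\in\mathbb{N})$ is a $\Re$-Leja sequence if and only if there exists a Leja sequence $E=(e_k: k\in\mathbb{N})$ such that $$X=(1,-1)\;\wedge\;\bigwedge_{j=1}^{\infty}\Re\Big(E(2^j:2^j+2^{j-1}-1)\Big).$$ Equivalently, $x_k=\Re(e_{\phi(k)})$ for all $k\in\mathbb{N}$, where $\phi(0)=0$, $\phi(1)=1$ and, for $k\ge 2$, $$\phi(k)=\begin{cases}\frac{3k}{2}-1 & \text{if } k=2^n \text{ for some } n\in\mathbb{N},\\ 2^{\lfloor\log_2(k)\rfloor}+k-1 & \text{if } k \text{ is not a power of } 2.\end{cases}$$
   Context: $\mathbb{N}=\{0,1,2,\dots\}$. Let $D=\{z\in\mathbb{C}: |z|\le 1\}$. A Leja sequence (for $D$) is a sequence $E=(e_k: k\in\mathbb{N})$ of points of $D$ with $e_0=1$ and, for every $j\ge 1$, $\prod_{m=0}^{j-1}|e_j-e_m|=\max_{z\in D}\prod_{m=0}^{j-1}|z-e_m|$. A $\Re$-Leja sequence is a sequence $X=X(E)$ in $[-1,1]$ for which there is a Leja sequence $E=(e_k:k\in\mathbb{N})$ such that $X$ is obtained from the sequence of real parts $(\Re(e_k): k\in\mathbb{N})$ by eliminating repeated values (each value is kept only at its first occurrence, the order being preserved). For a sequence $S=(s_k:k\in\mathbb{N})$, $S(j:k)=(s_j,s_{j+1},\dots,s_k)$. The real part $\Re$ of a tuple is taken entrywise. The symbol $\wedge$ denotes concatenation of tuples, $(x_1,\dots,x_m)\wedge(y_1,\dots,y_n)=(x_1,\dots,x_m,y_1,\dots,y_n)$,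 and $\bigwedge_{j=1}^\infty$ denotes successive concatenation in increasing order of $j$. $\lfloor\cdot\rfloor$ is the floor function. *)

(* Defs.v *)
From HB Require Import structures.
From mathcomp Require Import all_boot all_order all_algebra.
From mathcomp Require Import reals.
From mathcomp.real_closed Require Import complex.

Set Implicit Arguments.
Unset Strict Implicit.
Unset Printing Implicit Defensive.

Import Order.TTheory GRing.Theory Num.Theory.
Local Open Scope ring_scope.

(* On [R[i]] the norm takes values in [R[i]]; all the quantities compared
   below are real, where the order of [R[i]] is the usual one. *)
Definition unit_disk (R : realType) (z : R[i]) : Prop := `|z| <= 1.

Definition is_Leja (R : realType) (E : nat -> R[i]) : Prop :=
  [/\ forall k, unit_disk (E k),
      E 0%N = 1
    & forall j, (1 <= j)%N -> forall z, unit_disk z ->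
        \prod_(m < j) `|z - E m| <= \prod_(m < j) `|E j - E m| ].

(* [f] enumerates in increasing order the indices of the first occurrences
   of the values of [Y]. *)
Definition is_dedup (T : Type) (Y X : nat -> T) : Prop :=
  exists f : nat -> nat,
    [/\ {homo f : a b / (a < b)%N},
        forall n, (exists k, f k = n) <->
                  (forall m, (m < n)%N -> Y m <> Y n)
      & forall k, X k = Y (f k) ].

Definition is_ReLeja (R : realType) (X : nat -> R) : Prop :=
  (forall k, -1 <= X k <= 1) /\
  exists E : nat -> R[i], is_Leja E /\ is_dedup (fun k => complex.Re (E k)) X.

(* The tuple S(j:k); both end points are included. *)
Definition segment (T : Type) (S : nat -> T) (j k : nat) : seq T :=
  [seq S i | i <- iota j (k.+1 - j)%N].

(* [X] is the infinite sequence s ^ B 1 ^ B 2 ^ ... *)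
Definition is_concat (T : Type) (s : seq T) (B : nat -> seq T)
    (X : nat -> T) : Prop :=
  let P n := s ++ flatten [seq B j | j <- iota 1 n] in
  (forall k, exists n, (k < size (P n))%N) /\
  (forall n, mkseq X (size (P n)) = P n).

Definition ReLeja_block (R : realType) (E : nat -> R[i]) (j : nat) : seq R :=
  [seq complex.Re z | z <- segment E (2 ^ j)%N (2 ^ j + 2 ^ (j - 1) - 1)%N].

(* The exponent may be bounded by [k] because n < 2 ^ n. *)
Definition is_pow2 (k : nat) : bool := [exists n : 'I_k, k == (2 ^ n)%N].

(* For k >= 2, [trunc_log 2 k] is the floor of log_2 k; the division by 2 is
   exact, such a power of 2 being even. *)
Definition phi (k : nat) : nat :=
  if (k < 2)%N then k
  else if is_pow2 k then ((3 * k) %/ 2 - 1)%N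
  else (2 ^ trunc_log 2 k + k - 1)%N.

(* Main.v *)
Require Import Defs.
From mathcomp Require Import all_boot all_order all_algebra.
From mathcomp Require Import reals.
From mathcomp.real_closed Require Import complex.
From mathcomp Require Import zify ring.

Set Implicit Arguments.
Unset Strict Implicit.
Unset Printing Implicit Defensive.

Import Order.TTheory GRing.Theory Num.Theory.
Local Open Scope ring_scope.

(** The first [2 ^ n] points of a Leja sequence are the [2 ^ n]-th roots of
    unity, and the next [2 ^ n] points are [r * e'_i] where [r ^+ 2 ^ n = -1] and
    [e'] is again a finite Leja section. This goes by induction on [n]: the
    objective at step [2 ^ n + i] is [|z ^+ 2 ^ n - 1|] times the objective of
    [e'] at [z / r]; by induction the second factor is maximized at a
    [2 ^ n]-th root of unity, so both factors can be maximized simultaneously.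
    In particular maximizers are found algebraically, without compactness.

    Two points of the unit circle have the same real part iff they are equal or
    inverse to each other. The points of index [2 ^ n.+1 + i], [i < 2 ^ n], form
    the coset [r * U] of the [2 ^ n]-th roots of unity, with [r ^+ 2 ^ n.+1 = -1],
    so that the inverses fill the complementary half of the block. Hence the
    first half of each block brings only new real parts and the second half
    none, for every Leja sequence; [phi] enumerates these first halves. *)

(** * Finite Leja sections whose length is a power of two *)

Definition disk_argmax (C : numClosedFieldType) (E : nat -> C) (k : nat)
    (w : C) : Prop :=
  `|w| <= 1 /\ forall z, `|z| <= 1 ->
    \prod_(m < k) `|z - E m| <= \prod_(m < k) `|w - E m|.

Definition Leja_section (C : numClosedFieldType) (E : nat -> C) (N : nat) :
    Prop :=
  E 0%N = 1 /\
  forall j, (0 < j < N)%N -> disk_argmax E j (E j).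

Definition shifted (C : numClosedFieldType) (E : nat -> C) (N : nat) : nat -> C :=
  fun i => E (N + i)%N / E N.

Section LejaSections.
Variable C : numClosedFieldType.
Implicit Types (E : nat -> C) (w z : C).

Lemma Leja_sectionW E M N :
  (M <= N)%N -> Leja_section E N -> Leja_section E M.
Proof.
move=> MN [E0 EN]; split=> // j /andP[j0 jM]; apply: EN.
by rewrite j0 (leq_trans jM).
Qed.

Lemma norm_root_unity z N : (0 < N)%N -> `|z ^+ N| = 1 -> `|z| = 1.
Proof.
by move=> N0 /eqP; rewrite normrX pexpr_eq1 // => /eqP.
Qed.

Lemma norm_expB1_le2 z N : `|z| <= 1 -> `|z ^+ N - 1| <= 2.
Proof.
move=> z1; apply: (le_trans (ler_normB _ _)).
rewrite normr1 normrX -[2]/(1 + 1) lerD2r.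
by rewrite exprn_ile1.
Qed.

(** With [u = z ^+ N], the parallelogram identity gives |u + 1|^2 <= 4 - |u - 1|^2 <= 0. *)
Lemma expN1_max z N : `|z| <= 1 -> 2 <= `|z ^+ N - 1| -> z ^+ N = -1.
Proof.
move=> z1 h; set u := z ^+ N in h *.
have u1 : `|u| <= 1 by rewrite normrX exprn_ile1.
have h2 : `|u + 1| ^+ 2 + `|u - 1| ^+ 2 = 2 * `|u| ^+ 2 + 2.
  by rewrite !normCK !rmorphD rmorphN !rmorph1 /=; ring.
have : `|u + 1| ^+ 2 <= 0.
  have h4 : 2 ^+ 2 <= `|u - 1| ^+ 2 by rewrite lerXn2r ?nnegrE.
  have h5 : 2 * `|u| ^+ 2 <= 2 by rewrite ler_piMr ?exprn_ile1.
  have -> : `|u + 1| ^+ 2 = (2 * `|u| ^+ 2 + 2) - `|u - 1| ^+ 2.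
    by rewrite -h2 addrK.
  rewrite subr_le0; apply: le_trans h4.
  have -> : 2 ^+ 2 = 2 + 2 :> C by ring.
  by rewrite lerD2r.
by rewrite -normrX normr_le0 expf_eq0 /= addr_eq0 => /eqP.
Qed.

(** The clauses are carried through one induction. The second yields existence of a maximizer, the
    third constrains all of them. The step [k = 2 ^ n] is left out because its maximizers are roots
    of -1 instead, see [argmax_pow2]. *)
Definition pow2_spec (n : nat) : Prop :=
  [/\ forall E, Leja_section E (2 ^ n)%N ->
        forall z, \prod_(m < (2 ^ n)%N) (z - E m) = z ^+ (2 ^ n)%N - 1,
      forall E k, (0 < k < 2 ^ n)%N -> Leja_section E k ->
        exists w, disk_argmax E k w /\ w ^+ (2 ^ n)%N = 1
    & forall E k w, (0 < k < 2 ^ n)%N -> Leja_section E k ->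
        disk_argmax E k w -> w ^+ (2 ^ n)%N = 1].

Lemma exists_rootN1 N : (0 < N)%N -> exists z : C, z ^+ N = -1.
Proof. by move=> N0; exists (N.-root (-1)); rewrite rootCK. Qed.

Lemma argmax_pow2 n E w : pow2_spec n -> Leja_section E (2 ^ n)%N ->
  disk_argmax E (2 ^ n)%N w <-> w ^+ (2 ^ n)%N = -1.
Proof.
move=> [h1 _ _] /h1 hE.
have h z : \prod_(m < (2 ^ n)%N) `|z - E m| = `|z ^+ (2 ^ n)%N - 1|.
  by rewrite -normr_prod hE.
have N0 : (0 < 2 ^ n)%N by rewrite expn_gt0.
have n2 : `|-1 - 1 : C| = 2 by rewrite -opprD normrN ger0_norm // addr_ge0.
split=> [[w1 wM]|wN].
  have [z zN] := exists_rootN1 N0.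
  have z1 : `|z| = 1 by apply: (@norm_root_unity _ (2 ^ n)%N); rewrite // zN normrN1.
  apply: expN1_max => //; move: (wM z); rewrite z1 lexx !h zN n2; exact.
split; last by move=> z z1; rewrite !h wN n2 norm_expB1_le2.
by rewrite (@norm_root_unity _ (2 ^ n)%N) // wN normrN1.
Qed.

Lemma prod_shift n E k z : pow2_spec n -> Leja_section E (2 ^ n)%N ->
  `|E (2 ^ n)%N| = 1 ->
  \prod_(m < (2 ^ n + k)%N) `|z - E m| =
  `|z ^+ (2 ^ n)%N - 1| *
  \prod_(m < k) `|z / E (2 ^ n)%N - shifted E (2 ^ n)%N m|.
Proof.
move=> [h1 _ _] /h1 hE r1.
rewrite big_split_ord /= -normr_prod hE; congr (_ * _).
apply: eq_bigr => m _; rewrite /shifted -mulrBl normrM normfV r1 invr1 mulr1 //.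
Qed.

(** With r the point of index [2 ^ n] and w a maximizer for the shifted section that is a root of
    unity, the objective at r w is 2 times the shifted maximum. At v it is at most 2 times the
    shifted objective at v / r, so the factor 2 cancels. *)
Lemma shifted_argmax n E k v : pow2_spec n ->
    Leja_section E (2 ^ n)%N -> disk_argmax E (2 ^ n)%N (E (2 ^ n)%N) ->
    (0 < k < 2 ^ n)%N -> Leja_section (shifted E (2 ^ n)%N) k ->
    disk_argmax E (2 ^ n + k)%N v ->
  disk_argmax (shifted E (2 ^ n)%N) k (v / E (2 ^ n)%N).
Proof.
move=> hn hE hr k0 hS [v1 hv]; have [_ h3 _] := hn.
have rN := (argmax_pow2 _ hn hE).1 hr.
set N := (2 ^ n)%N in hr hS hv rN h3 *; set r := E N in hr rN *.
have r1 : `|r| = 1.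
  by apply: (@norm_root_unity _ N); rewrite ?expn_gt0 // rN normrN1.
have [w [[w1 hw] wN]] := h3 _ _ k0 hS.
split; first by rewrite normrM normfV r1 invr1 mulr1.
move=> z z1; apply: (le_trans (hw _ z1)).
move: (hv (r * w)); rewrite normrM r1 mul1r => /(_ w1).
rewrite !(prod_shift _ _ hn hE r1) exprMn rN wN mulr1.
have r0 : r != 0 by rewrite -normr_eq0 r1 oner_eq0.
rewrite [r * w]mulrC mulfK //.
rewrite -opprD normrN ger0_norm ?addr_ge0 // => h.
have h2 := norm_expB1_le2 N v1.
rewrite -(ler_pM2l (ltr0n C 2)); apply: (le_trans h).
by rewrite ler_wpM2r // prodr_ge0.
Qed.

Lemma shifted_section n E k : pow2_spec n -> (0 < k <= 2 ^ n)%N ->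
  Leja_section E (2 ^ n + k)%N -> Leja_section (shifted E (2 ^ n)%N) k.
Proof.
move=> hn; case: k => // k; elim: k => [|k IH] /= kn hE.
  have hN := Leja_sectionW (leq_addr _ _) hE.
  have hr : disk_argmax E (2 ^ n)%N (E (2 ^ n)%N).
    by apply: hE.2; rewrite expn_gt0 /= addn1.
  have rN := (argmax_pow2 _ hn hN).1 hr.
  split; last by move=> [|[]].
  rewrite /shifted addn0 divff //; apply/eqP => r0.
  by move/eqP: rN; rewrite r0 expr0n expn_eq0 /= eq_sym oppr_eq0 oner_eq0.
have hN := Leja_sectionW (leq_addr _ _) hE.
have hr : disk_argmax E (2 ^ n)%N (E (2 ^ n)%N).
  by apply: hE.2; rewrite expn_gt0 /= addnS ltnS leq_addr.
have {}IH : Leja_section (shifted E (2 ^ n)) k.+1.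
  by apply: IH; [exact: ltnW | apply: Leja_sectionW hE; rewrite leq_add2l].
split; first exact: IH.1.
move=> j /andP[j0]; rewrite ltnS leq_eqVlt => /orP[/eqP ->|jk]; last first.
  by apply: IH.2; rewrite j0.
apply: shifted_argmax => //.
by apply: hE.2; rewrite addnS ltn0Sn -addnS ltn_add2l ltnSn.
Qed.

Lemma section_rootN1 n E k : pow2_spec n -> (2 ^ n < k)%N ->
  Leja_section E k -> E (2 ^ n)%N ^+ (2 ^ n)%N = -1.
Proof.
move=> hn nk hE; apply/(argmax_pow2 _ hn (Leja_sectionW (ltnW nk) hE)).
by apply: hE.2; rewrite expn_gt0 nk.
Qed.

Lemma pow2_specS n : pow2_spec n -> pow2_spec n.+1.
Proof.
move=> hn; have [h1 h2 h3] := hn.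
have N0 : (0 < 2 ^ n)%N by rewrite expn_gt0.
have e2 : (2 ^ n.+1 = 2 ^ n + 2 ^ n)%N by rewrite expnS mul2n addnn.
have rP z : z ^+ (2 ^ n)%N = -1 -> `|z| = 1 /\ z != 0.
  move=> zN; have z1 : `|z| = 1.
    by apply: (@norm_root_unity _ (2 ^ n)%N); rewrite // zN normrN1.
  by rewrite -normr_eq0 z1 oner_eq0.
have exp2 z : z ^+ (2 ^ n)%N = 1 \/ z ^+ (2 ^ n)%N = -1 -> z ^+ (2 ^ n.+1)%N = 1.
  by rewrite e2 exprD => -[] ->; rewrite ?mulr1 ?mulrNN ?mulr1.
split.
- move=> E hE z.
  have hr : E (2 ^ n)%N ^+ (2 ^ n)%N = -1.
    by apply: (section_rootN1 hn _ hE); rewrite e2 -addn1 leq_add2l.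
  have [_ r0] := rP _ hr.
  have hS : Leja_section (shifted E (2 ^ n)%N) (2 ^ n)%N.
    by apply: shifted_section; rewrite // ?N0 ?leqnn // -e2.
  have hE' : Leja_section E (2 ^ n)%N.
    by apply: Leja_sectionW hE; rewrite e2 leq_addr.
  (* With N = 2^n and r^N = -1, the second half of the product is r^N ((z/r)^N - 1) = z^N + 1. *)
  rewrite e2 big_split_ord /= (h1 _ hE').
  rewrite (eq_bigr (fun m : 'I__ => (E (2 ^ n)%N) *
      (z / E (2 ^ n)%N - shifted E (2 ^ n) m))); last first.
    by move=> m _; rewrite /shifted -mulrBl mulrC mulfVK.
  rewrite big_split /= prodr_const card_ord (h1 _ hS) hr.
  rewrite expr_div_n hr exprD invrN invr1 mulrN1.
  by ring.
- move=> E k /andP[k0 kn] hE; have [kN|Nk|kN] := ltngtP k (2 ^ n)%N.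
  + have [|w [wM wN]] := h2 E k _ hE; first by rewrite k0.
    by exists w; split=> //; apply: exp2; left.
  + have hr := section_rootN1 hn Nk hE.
    have [r1 r0] := rP _ hr.
    have [l kE] : exists l, k = (2 ^ n + l)%N.
      by exists (k - 2 ^ n)%N; rewrite subnKC // ltnW.
    have hE' : Leja_section E (2 ^ n)%N := Leja_sectionW (ltnW Nk) hE.
    have l0 : (0 < l < 2 ^ n)%N by lia.
    have hS : Leja_section (shifted E (2 ^ n)%N) l.
      by apply: shifted_section; rewrite -?kE //; lia.
    have [w [[w1 wM] wN]] := h2 _ _ l0 hS.
    (* This point attains the bound 2 in the first factor and the maximum in the shifted one. *)
    exists (E (2 ^ n)%N * w); split; last first.
      by apply: exp2; right; rewrite exprMn hr wN mulr1.
    split; first by rewrite normrM r1 mul1r.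
    move=> z z1; rewrite kE !(prod_shift _ _ hn hE' r1).
    rewrite exprMn hr wN mulr1 [_ * w]mulrC mulfK //.
    rewrite -opprD normrN [X in _ <= X * _]ger0_norm ?addr_ge0 //.
    apply: ler_pM; rewrite ?prodr_ge0 ?norm_expB1_le2 //.
    by apply: wM; rewrite normrM normfV r1 invr1 mulr1.
  + have [w wN] := exists_rootN1 N0.
    exists w; split; last by apply: exp2; right.
    by rewrite kN in hE *; apply/(argmax_pow2 _ hn hE).
- move=> E k w /andP[k0 kn] hE hw; have [kN|Nk|kN] := ltngtP k (2 ^ n)%N.
  + by apply: exp2; left; apply: (h3 E k) => //; rewrite k0.
  + have hr := section_rootN1 hn Nk hE.
    have [r1 r0] := rP _ hr.
    have [l kE] : exists l, k = (2 ^ n + l)%N.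
      by exists (k - 2 ^ n)%N; rewrite subnKC // ltnW.
    have hE' : Leja_section E (2 ^ n)%N := Leja_sectionW (ltnW Nk) hE.
    have l0 : (0 < l < 2 ^ n)%N by lia.
    have hS : Leja_section (shifted E (2 ^ n)%N) l.
      by apply: shifted_section; rewrite -?kE //; lia.
    have hrM : disk_argmax E (2 ^ n)%N (E (2 ^ n)%N).
      by apply: hE.2; rewrite N0.
    rewrite kE in hw; have hv := shifted_argmax hn hE' hrM l0 hS hw.
    have := h3 _ _ _ l0 hS hv.
    rewrite expr_div_n hr invrN invr1 mulrN1 => wN.
    by apply: exp2; right; rewrite -wN opprK.
  + by apply: exp2; right; rewrite kN in hE hw; apply/(argmax_pow2 _ hn hE).
Qed.

Lemma pow2_specP n : pow2_spec n.
Proof.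
elim: n => [|n]; last exact: pow2_specS.
split=> [E [E0 _] z|E [|[]] //|E [|[]] //].
by rewrite expn0 big_ord1 E0 expr1.
Qed.

Lemma section_root n E k : Leja_section E (2 ^ n)%N -> (k < 2 ^ n)%N ->
  E k ^+ (2 ^ n)%N = 1.
Proof.
have [h1 _ _] := pow2_specP n.
move=> /h1 /(_ (E k)) hE kn; apply/eqP; rewrite -subr_eq0 -hE.
by rewrite (bigD1 (Ordinal kn)) //= subrr mul0r.
Qed.

(** The nodal polynomial of the section vanishes at [z], hence so does one of its factors. *)
Lemma section_surj n E z : Leja_section E (2 ^ n)%N -> z ^+ (2 ^ n)%N = 1 ->
  exists2 m, (m < 2 ^ n)%N & z = E m.
Proof.
have [h1 _ _] := pow2_specP n.
move=> /h1 /(_ z) hE zn; move/eqP: hE; rewrite zn subrr.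
rewrite prodf_seq_eq0 => /hasP[/= m _]; rewrite subr_eq0 => /eqP ->.
by exists m.
Qed.

(** * Repetitions and inverse pairs in an infinite Leja sequence *)

Section InfiniteLeja.
Variables (E : nat -> C) (hE : forall N, Leja_section E N).

Let shifted_pow2 n : Leja_section (shifted E (2 ^ n)%N) (2 ^ n)%N.
Proof.
by apply: shifted_section; rewrite ?expn_gt0 ?leqnn //; exact: pow2_specP.
Qed.

Lemma Leja_lead_rootN1 n : E (2 ^ n)%N ^+ (2 ^ n)%N = -1.
Proof. exact: (section_rootN1 (pow2_specP n) (ltnSn _)). Qed.

Lemma Leja_neq0 k : E k != 0.
Proof.
(* Since k < 2^k, every entry lies in some section of power-of-two length. *)
apply/eqP => k0; move: (section_root (hE (2 ^ k)%N) (@ltn_expl 2 k isT)).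
by move/eqP; rewrite k0 expr0n expn_eq0 /= eq_sym oner_eq0.
Qed.

Lemma Leja_shiftE n k : E (2 ^ n + k)%N = E (2 ^ n)%N * shifted E (2 ^ n)%N k.
Proof. by rewrite /shifted mulrC mulfVK ?Leja_neq0. Qed.

Lemma Leja_rootN1 n k : (k < 2 ^ n)%N -> E (2 ^ n + k)%N ^+ (2 ^ n)%N = -1.
Proof.
move=> kn; rewrite Leja_shiftE exprMn Leja_lead_rootN1.
by rewrite (section_root (shifted_pow2 n) kn) mulr1.
Qed.

Lemma N1_neq1 : -1 != 1 :> C.
Proof. by rewrite eq_sym -addr_eq0 (pnatr_eq0 C 2). Qed.

Lemma Leja_neq m j : (m < j)%N -> E m != E j.
Proof.
move=> mj; have jj : (j < 2 ^ j)%N := @ltn_expl 2 j isT.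
(* The point of index 2^j differs from all earlier ones, which are 2^j-th roots of unity. So the
   maximum at step [j] is positive, whereas a repetition would make it zero. *)
have h : 0 < \prod_(i < j) `|E (2 ^ j)%N - E i|.
  apply: prodr_gt0 => i _; rewrite normr_gt0 subr_eq0.
  apply/eqP => e; have := Leja_lead_rootN1 j; rewrite e.
  rewrite (section_root (hE _)) ?(ltn_trans (ltn_ord i)) //.
  by move/eqP; rewrite eq_sym (negPf N1_neq1).
have j0 : (0 < j)%N by apply: leq_ltn_trans mj.
have [_ hj] : disk_argmax E j (E j) by apply: (hE j.+1).2; rewrite j0 /=.
have [h1 _] : disk_argmax E (2 ^ j) (E (2 ^ j)%N).
  by apply: (hE (2 ^ j).+1).2; rewrite expn_gt0 /=.
have := lt_le_trans h (hj _ h1).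
rewrite (bigD1 (Ordinal mj)) //=; case: eqP => // ->.
by rewrite subrr normr0 mul0r ltxx.
Qed.

Lemma Leja_norm1 k : `|E k| = 1.
Proof.
apply: (@norm_root_unity _ (2 ^ k)%N); first by rewrite expn_gt0.
by rewrite (section_root (hE (2 ^ k)%N) (@ltn_expl 2 k isT)) normr1.
Qed.

(** A power of the product equals -1: the 2^(n+1)-th if [m] precedes the block; otherwise the
    2^n-th, both points being r times a 2^n-th root of unity, with r^(2^(n+1)) = -1. *)
Lemma Leja_inv_new n k m : (k < 2 ^ n)%N -> (m < 2 ^ n.+1 + k)%N ->
  E m * E (2 ^ n.+1 + k)%N != 1.
Proof.
move=> kn mk; have e2 : (2 ^ n.+1 = 2 ^ n + 2 ^ n)%N.
  by rewrite expnS mul2n addnn.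
apply/eqP => h; have [mN|Nm] := ltnP m (2 ^ n.+1)%N.
  have := congr1 (fun z => z ^+ (2 ^ n.+1)%N) h.
  rewrite exprMn expr1n Leja_rootN1; last by lia.
  by rewrite (section_root (hE (2 ^ n.+1)%N) mN) mul1r => /eqP; rewrite (negPf N1_neq1).
have [i mE] : exists i, m = (2 ^ n.+1 + i)%N.
  by exists (m - 2 ^ n.+1)%N; rewrite subnKC.
have hS := Leja_sectionW _ (shifted_pow2 n.+1).
have := congr1 (fun z => z ^+ (2 ^ n)%N) h.
rewrite mE !(Leja_shiftE n.+1) mulrACA 3!exprMn expr1n.
rewrite !(section_root (hS (2 ^ n)%N _)) //; try lia.
rewrite !mulr1 -exprD -e2 Leja_lead_rootN1 => /eqP.
by rewrite (negPf N1_neq1).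
Qed.

Lemma Leja_inv_old n k : (2 ^ n <= k < 2 ^ n.+1)%N ->
  exists2 m, (m < 2 ^ n.+1 + k)%N & E m * E (2 ^ n.+1 + k)%N = 1.
Proof.
move=> /andP[nk kn]; have e2 : (2 ^ n.+1 = 2 ^ n + 2 ^ n)%N.
  by rewrite expnS mul2n addnn.
have hS : Leja_section (shifted E (2 ^ n.+1)) (2 ^ n)%N.
  by apply: Leja_sectionW (shifted_pow2 n.+1); rewrite e2 leq_addr.
set r := E (2 ^ n.+1)%N; set w := shifted E (2 ^ n.+1)%N k.
have wE : E (2 ^ n.+1 + k)%N = r * w by rewrite Leja_shiftE.
have wN : w ^+ (2 ^ n)%N = -1.
  have : (w ^+ (2 ^ n)%N) ^+ 2 = 1.
    by rewrite -exprM muln2 -mul2n -expnS (section_root (shifted_pow2 n.+1)).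
  (* The value 1 would place [w] in the first half of the shifted section and so repeat a point. *)
  move/eqP; rewrite sqrf_eq1 => /orP[/eqP w1|/eqP //].
  have [m mn wm] := section_surj hS w1.
  have : E (2 ^ n.+1 + m)%N != E (2 ^ n.+1 + k)%N by apply: Leja_neq; lia.
  by rewrite wE wm Leja_shiftE eqxx.
have r0 : r != 0 := Leja_neq0 _.
have w0 : w != 0.
  by have := Leja_neq0 (2 ^ n.+1 + k); rewrite wE mulf_eq0 (negPf r0).
(* The inverse of r w is r times this element, whose 2^n-th power is (-1)(-1) = 1. *)
have [|m mn um] := @section_surj n _ (r ^- 2 * w^-1) hS.
  rewrite exprMn !exprVn -exprM -expnS Leja_lead_rootN1 wN.
  by rewrite -invfM mulrNN mulr1 invr1.
exists (2 ^ n.+1 + m)%N; first lia.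
rewrite wE Leja_shiftE -/r -um; field; by rewrite r0 w0.
Qed.

End InfiniteLeja.

End LejaSections.

(** * Equal real parts on the unit circle *)

Section RealParts.
Variable R : realType.
Implicit Types z w : R[i].

Lemma is_Leja_section (E : nat -> R[i]) N : is_Leja E -> Leja_section E N.
Proof. by move=> [E1 E0 EM]; split=> // j /andP[j0 _]; split; [exact: E1|exact: EM]. Qed.

Lemma eq_Re_unit_circle z w : `|z| = 1 -> `|w| = 1 ->
  complex.Re z = complex.Re w <-> z = w \/ z * w = 1.
Proof.
have inv u : `|u| = 1 -> u != 0 /\ u + u^-1 = 2 * (complex.Re u)%:C%C.
  move=> u1; have u0 : u != 0 by rewrite -normr_eq0 u1 oner_eq0.
  split=> //; rewrite -addcJ; congr (_ + _).
  apply: (mulfI u0); rewrite divff //.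
  by rewrite -sqr_normc u1 expr1n.
move=> /inv[z0 zE] /inv[w0 wE].
(* On the circle z + 1/z is twice the real part, so this factorization gives both alternatives. *)
have zw : (z - w) * (z * w - 1) = z * w * ((z + z^-1) - (w + w^-1)).
  by field; rewrite z0 w0.
split=> [e|h].
  move/eqP: zw; rewrite zE wE e subrr mulr0 mulf_eq0 !subr_eq0.
  by move=> /orP[/eqP ->|/eqP ->]; [left|right].
have : (z - w) * (z * w - 1) = 0.
  by case: h => ->; rewrite subrr ?mulr0 ?mul0r.
rewrite zw zE wE => /eqP; rewrite !mulf_eq0 (negPf z0) (negPf w0) /= -mulrBr.
by rewrite mulf_eq0 (pnatr_eq0 _ 2) /= subr_eq0 => /eqP [].
Qed.

End RealParts.

(** * Index arithmetic of [phi] and of the blocks *)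

Lemma phi_block n i : (i < 2 ^ n)%N -> phi (2 ^ n + 1 + i) = (2 ^ n.+1 + i)%N.
Proof.
move=> hi; have n0 : (0 < 2 ^ n)%N by rewrite expn_gt0.
have e2 : (2 ^ n.+1 = 2 ^ n + 2 ^ n)%N by rewrite expnS mul2n addnn.
rewrite /phi ifF; last by lia.
(* The block of arguments ends at the power k = 2^(n+1), where the logarithm has already jumped;
   there 3k/2 - 1 = 2^(n+1) + 2^n - 1. *)
case: ifPn => [/existsP[[m /= _] /eqP mE]|/negP h].
  have mn : m = n.+1.
    apply/eqP; rewrite eqn_leq -ltnS -(@ltn_exp2l 2) // -(@leq_exp2l 2 n.+1) //.
    have : (n < m)%N by rewrite -(@ltn_exp2l 2) //; lia.
    by rewrite -(@leq_exp2l 2) // => ->; rewrite andbT -mE [(2 ^ n.+2)%N]expnS; lia.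
  by rewrite mn in mE; lia.
rewrite (@trunc_log_eq 2 n) //; first lia.
apply/andP; split; first lia.
have := ltn_neqAle (2 ^ n + 1 + i) (2 ^ n.+1).
have -> : (2 ^ n + 1 + i <= 2 ^ n.+1)%N by lia.
rewrite andbT => ->; apply/eqP => e; apply: h; apply/existsP.
have hn : (n.+1 < 2 ^ n + 1 + i)%N by rewrite e; apply: ltn_expl.
by exists (Ordinal hn); apply/eqP.
Qed.

Lemma block_decomp k : (1 < k)%N ->
  exists n i, (i < 2 ^ n)%N /\ k = (2 ^ n + 1 + i)%N.
Proof.
case: k => // k k0; have k1 : (0 < k)%N by [].
have h1 := trunc_logP (isT : 1 < 2)%N k1.
have := trunc_log_ltn k (isT : 1 < 2)%N.
rewrite expnS => h2.
(* [k] is now the predecessor of the given index: blocks run from 2^n + 1 through 2^(n+1). *)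
exists (trunc_log 2 k), (k - 2 ^ trunc_log 2 k)%N; lia.
Qed.

Lemma phi_lt_succ k : (phi k < phi k.+1)%N.
Proof.
case: k => [|[|k]]; [by []|by rewrite (@phi_block 0 0)|].
have [//|n [i [hi ->]]] := @block_decomp k.+2.
have e2 : (2 ^ n.+1 = 2 ^ n + 2 ^ n)%N by rewrite expnS mul2n addnn.
rewrite phi_block //.
have [hi'|hi'] := ltnP i.+1 (2 ^ n).
  by rewrite -(addnS (2 ^ n + 1)) phi_block // ltn_add2l.
have -> : (2 ^ n + 1 + i).+1 = (2 ^ n.+1 + 1 + 0)%N by lia.
have := @expn_gt0 2 n.+1.
rewrite phi_block ?expn_gt0 // [(2 ^ n.+2)%N]expnS; lia.
Qed.

Lemma phi_mono : {homo phi : a b / (a < b)%N}.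
Proof. by apply: homo_ltn phi_lt_succ => ? ? ?; apply: ltn_trans. Qed.

(** This identifies the unspecified enumeration in [is_dedup] with [phi]. If v k = u l with l < k,
    induction would give u l <= v l < v k. *)
Lemma eq_increasing_image (f g : nat -> nat) :
  {homo f : a b / (a < b)%N} -> {homo g : a b / (a < b)%N} ->
  (forall n, (exists k, f k = n) <-> (exists k, g k = n)) -> f =1 g.
Proof.
have le (u v : nat -> nat) : {homo u : a b / (a < b)%N} ->
    {homo v : a b / (a < b)%N} ->
    (forall n, (exists k, v k = n) -> (exists k, u k = n)) ->
    forall k, (u k <= v k)%N.
  move=> hu hv huv k; elim/ltn_ind: k => k IH.
  have [|l lk] := huv (v k); first by exists k.
  have [kl|lk'] := leqP k l.
    by rewrite -lk; have /ltnW_homo := hu; apply.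
  have := leq_ltn_trans (IH _ lk') (hv _ _ lk').
  by rewrite lk ltnn.
move=> hf hg h k; apply/eqP; rewrite eqn_leq.
by rewrite !le // => n /h.
Qed.

Lemma segment_pow2 (T : Type) (S : nat -> T) n :
  segment S (2 ^ n.+1) (2 ^ n.+1 + 2 ^ (n.+1 - 1) - 1) =
  [seq S (2 ^ n.+1 + i)%N | i <- iota 0 (2 ^ n)].
Proof.
have n0 : (0 < 2 ^ n)%N by rewrite expn_gt0.
rewrite /segment [(n.+1 - 1)%N]subn1 succnK; have -> : ((2 ^ n.+1 + 2 ^ n - 1).+1 - 2 ^ n.+1 = 2 ^ n)%N by lia.
by rewrite -{1}[(2 ^ n.+1)%N]addn0 iotaDl -map_comp.
Qed.

(** * Concatenated blocks and first occurrences of real parts *)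

Section ReLeja.
Variables (R : realType) (E : nat -> R[i]).
Hypothesis hE : is_Leja E.

Let sE N := is_Leja_section N hE.

Lemma concat_prefix n :
  [:: 1; -1] ++ flatten [seq ReLeja_block E j | j <- iota 1 n] =
  mkseq (fun k => complex.Re (E (phi k))) (2 ^ n + 1).
Proof.
elim: n => [|n IH].
  have := Leja_lead_rootN1 sE 0; rewrite /= expr1 => E1.
  by have [_ E0 _] := hE; rewrite /mkseq /= E0 E1.
rewrite -(addn1 n) iotaD map_cat flatten_cat catA IH /= cats0 (addn1 n) add1n.
rewrite /ReLeja_block segment_pow2 -map_comp.
have -> : (2 ^ n.+1 + 1 = (2 ^ n + 1) + 2 ^ n)%N by rewrite expnS; lia.
rewrite /mkseq (iotaD 0 (2 ^ n + 1) (2 ^ n)) map_cat; congr (_ ++ _).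
rewrite add0n -[(2 ^ n + 1)%N]addn0 iotaDl -map_comp.
apply/eq_in_map => i; rewrite mem_iota add0n => /= hi.
by rewrite phi_block.
Qed.

Lemma is_concat_phi (X : nat -> R) :
  is_concat [:: 1; -1] (ReLeja_block E) X <->
  forall k, X k = complex.Re (E (phi k)).
Proof.
have lt_pow k : (k < 2 ^ k + 1)%N by rewrite addn1 ltnW // ltnS ltn_expl.
split=> [[_ h] k|h].
  have := congr1 (nth 0 ^~ k) (h k); rewrite concat_prefix size_mkseq.
  by rewrite !nth_mkseq.
split=> n; last by rewrite concat_prefix size_mkseq; exact: eq_mkseq.
by exists n; rewrite concat_prefix size_mkseq.
Qed.

Lemma first_occurrence_phi n :
  (exists k, phi k = n) <->
  (forall m, (m < n)%N -> complex.Re (E m) <> complex.Re (E n)).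
Proof.
have N1 k : `|E k| = 1 := Leja_norm1 sE k.
split=> [[k <-] m|].
  move=> mk /(eq_Re_unit_circle (N1 _) (N1 _))[/eqP|].
    by rewrite (negPf (Leja_neq sE mk)).
  move: mk; have [k2|k1] := ltnP 1 k.
    have [p [i [hi ->]]] := block_decomp k2; rewrite phi_block // => mk /eqP.
    by rewrite (negPf (Leja_inv_new sE hi mk)).
  (* Indices 0 and 1 precede the blocks; the points there are 1 and -1, whose product is not 1. *)
  case: k k1 => [|[]] //= _; case: m => // _.
  have := Leja_lead_rootN1 sE 0; rewrite /= expr1 => ->.
  have [_ -> _] := hE; rewrite mul1r => /eqP.
  by rewrite (negPf (N1_neq1 _)).
case: n => [_|[_|n h]]; [by exists 0%N|by exists 1%N|].
have n0 : (0 < n.+2)%N by [].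
have h1 := trunc_logP (isT : 1 < 2)%N n0.
have h2 := trunc_log_ltn n.+2 (isT : 1 < 2)%N.
have : (0 < trunc_log 2 n.+2)%N by rewrite trunc_log_gt0.
case: (trunc_log 2 n.+2) h1 h2 => // p h1 h2 _.
have [i nE] : exists i, n.+2 = (2 ^ p.+1 + i)%N.
  by exists (n.+2 - 2 ^ p.+1)%N; rewrite subnKC.
(* An index in the first half of its block is a value of [phi]; one in the second half has an
   earlier inverse, hence an old real part. *)
have [ip|pi] := ltnP i (2 ^ p).
  by exists (2 ^ p + 1 + i)%N; rewrite phi_block.
have [|m mn mE] := @Leja_inv_old _ _ sE p i.
  by rewrite pi /=; move: h2; rewrite nE [(2 ^ p.+2)%N]expnS; lia.
have [] := h m; first by rewrite nE.
by apply/(eq_Re_unit_circle (N1 _) (N1 _)); right; rewrite nE.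
Qed.

Lemma is_dedup_phi (X : nat -> R) :
  is_dedup (fun k => complex.Re (E k)) X <->
  forall k, X k = complex.Re (E (phi k)).
Proof.
split=> [[f [fm fi fX]] k|h]; last first.
  by exists phi; split=> //; [exact: phi_mono | exact: first_occurrence_phi].
rewrite fX; congr (complex.Re (E _)).
apply: eq_increasing_image k => //; first exact: phi_mono.
by move=> n; rewrite fi first_occurrence_phi.
Qed.

Lemma Re_Leja_bounds k : -1 <= complex.Re (E k) <= 1.
Proof.
rewrite -ler_norml -lecR; apply: le_trans (normc_ge_Re _) _.
by rewrite (Leja_norm1 sE).
Qed.

End ReLeja.

Theorem theorem2p4 (R : realType) (X : nat -> R) :
  (is_ReLeja X <->
     exists E : nat -> R[i],
       is_Leja E /\ is_concat [:: 1; -1] (ReLeja_block E) X) /\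
  (forall E : nat -> R[i], is_Leja E ->
     (is_concat [:: 1; -1] (ReLeja_block E) X <->
      forall k : nat, X k = complex.Re (E (phi k)))).
Proof.
split; last by move=> E hE; exact: is_concat_phi.
split=> [[_ [E [hE hX]]]|[E [hE hX]]].
  by exists E; split=> //; apply/is_concat_phi/is_dedup_phi.
split; last by exists E; split=> //; apply/is_dedup_phi/is_concat_phi.
by move=> k; rewrite (is_concat_phi hE X).1 // Re_Leja_bounds.
Qed.
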